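(* Let $n \geq 2$ and $m \geq 41$ be integers. For all but at most a fraction $\left(\frac{48 \lg n}{\lg m}\right)^{1/4}$ of the vertices $L$ of $\mathcal{T}([m]^n)$, $$\deg(L) \;\geq\; m^n \left( 1 - \left( \frac{48 \lg n}{\lg m} \right)^{1/4} \right).$$ In particular, if $m\to\infty$ and $n = n(m) \ge 2$ satisfies $n = e^{o(\log m)}$, then the graph $\mathcal{T}([m]^n)$ is almost regular.
   Context: Write $[m]=\{1,\ldots,m\}$, and let $\lg$ denote the logarithm to base $2$. The grid $[m]^n$ is the product of $n$ chains of length $m$, i.e., the set of vectors $(x_1,\ldots,x_n)$ with $x_i\in[m]$, ordered coordinatewise. For a finite poset $P$, a linear extension is a bijection $L: P \to \{1,\ldots,|P|\}$ such that $x \prec y$ in $P$ implies $L(x)<L(y)$. The transposition graph $\mathcal{T}(P)$ is the graph whose vertices are the linear extensions of $P$, two of them being adjacent when one is obtained from the other by swapping the elements in two consecutive positions $a, a+1$ of the ordering; $\deg(L)$ is the degree of $L$ in this graph. ''Almost regular'' means that all but a fraction $o(1)$ of the vertices have degree at least $(1-o(1))$ times the maximum degree of the graph, as $m\to\infty$. *)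

(* Defs.v *)
From HB Require Import structures.
From mathcomp Require Import all_boot all_order all_algebra all_fingroup.
From mathcomp Require Import all_classical all_reals all_analysis.

Set Implicit Arguments.
Unset Strict Implicit.
Unset Printing Implicit Defensive.

Import Order.TTheory GRing.Theory Num.Theory.
Import numFieldNormedType.Exports.

Local Open Scope classical_set_scope.
Local Open Scope ring_scope.

(* Coordinates and positions are numbered from 0: 'I_m stands for {1, .., m}. *)
Definition grid (n m : nat) : finPOrderType _ := n.-tupleprod 'I_m.

Definition is_linext d (P : finPOrderType d) (L : {ffun P -> 'I_#|P|}) : bool :=
  `[< bijective L >] &&
  [forall x, forall y, (x < y)%O ==> (L x < L y)%N].

Record linext d (P : finPOrderType d) := Linext {
  linext_fun :> {ffun P -> 'I_#|P|};
  _ : is_linext linext_fun }.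

HB.instance Definition _ d (P : finPOrderType d) :=
  [isSub for @linext_fun d P].
HB.instance Definition _ d (P : finPOrderType d) :=
  [Finite of linext P by <:].

(* The transposition acts on positions, that is, on the values of L. *)
Definition transp_adj d (P : finPOrderType d) : rel (linext P) :=
  fun L L' => [exists a : 'I_#|P|, exists b : 'I_#|P|,
    (b == a.+1 :> nat) && [forall x, L' x == tperm a b (L x)]].

(* Finite simple graphs are given by a vertex type and an adjacency relation. *)
Definition degree (T : finType) (e : rel T) (x : T) : nat := #|[pred y | e x y]|.

Definition max_degree (T : finType) (e : rel T) : nat :=
  (\max_(x : T) degree e x)%N.

Definition all_but_fraction (R : realType) (T : finType) (c : R) (A : pred T) :
    Prop :=
  #|[pred x | ~~ A x]|%:R <= c * #|T|%:R.

(* eps and delta are the two o(1) terms; delta does not depend on the vertex. *)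
Definition almost_regular (R : realType) (T : nat -> finType)
    (e : forall m, rel (T m)) : Prop :=
  exists eps delta : nat -> R,
    [/\ eps @ \oo --> (0 : R), delta @ \oo --> (0 : R) &
      \forall m \near \oo, all_but_fraction (eps m)
        (fun x : T m => (1 - delta m) * (max_degree (@e m))%:R
                          <= (degree (@e m) x)%:R)].

Definition lg (R : realType) (x : R) : R := ln x / ln 2.

(* Main.v *)
Require Import Defs.
From mathcomp Require Import all_boot all_order all_algebra all_fingroup.
From mathcomp Require Import all_classical all_reals all_analysis.
From mathcomp Require Import zify ring lra.

(** Call a position of a linear extension L a bump when the element there lies
    above the element just before it.  Swapping the elements at positions a and
    a + 1 gives a linear extension exactly when a + 1 is not a bump, so with
    N = m^n elements the degree of L is at least N - 1 - (number of bumps), and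
    at most N; the theorem says that few linear extensions have many bumps.

    Extensions with many bumps can be encoded cheaply.  Record, at each bump,
    which of the n coordinates increases: consecutive comparable elements form
    a covering pair, so this determines the element from its predecessor.
    At any other position record the line parallel to the first axis that
    contains the element, one of w = m^(n-1) lines: a line is a chain, whose
    elements occur in increasing order, so the element is the first unused one
    of its line.  Giving each non-bump the weight n and each bump the weight w,
    the words on these n + w letters have total weight (2nw)^N, whence
    sum_L w^(bumps L) n^(N - bumps L) <= (2nw)^N ([sum_bumps_le]).

    Conversely there are many linear extensions.  The coordinate sum takes
    fewer than nm values, so by pigeonhole at least N! / (nm)^N permutations of
    the grid preserve it, and composing one sorting of the grid by coordinate
    sum with them gives distinct linear extensions ([fact_le_linext]).  As
    N^N <= 4^N N!, their number is at least (w / 4n)^N.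

    Hence the fraction of extensions with at least t bumps is at most
    (8n)^N (n/w)^t <= (8n)^N (n/m)^t ([many_bumps_rare]).  Put
    x = 48 lg n / lg m.  If x <= 1 and t = xN/2 then
    (m/n)^t is at least n^(23.5 N) while (8n)^N <= n^(4N), so
    the fraction is below exp(-N) <= x, and x <= x^(1/4) gives the bound; if
    x > 1 there is nothing to prove.  Almost regularity follows since x tends
    to 0 when ln n = o(ln m). *)

Import Order.TTheory GRing.Theory Num.Theory.
Import numFieldNormedType.Exports.

Set Implicit Arguments.
Unset Strict Implicit.
Unset Printing Implicit Defensive.

(** * Bumps and degrees *)

Lemma linext_lt d (P : finPOrderType d) (L : linext P) (x y : P) :
  (x < y)%O -> L x < L y.
Proof.
case: L => L /= /andP[_ /forallP /(_ x) /forallP /(_ y) /implyP]; exact.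
Qed.

Lemma linext_inj d (P : finPOrderType d) (L : linext P) : injective L.
Proof. by case: L => L /= /andP[/asboolP /bij_inj ? _]. Qed.

Lemma linext_codom d (P : finPOrderType d) (L : linext P) a : a \in codom L.
Proof.
case: L => L /= /andP[/asboolP [g _ gK] _].
by rewrite -[a]gK codom_f.
Qed.

Definition at_pos d (P : finPOrderType d) (L : linext P) (a : 'I_#|P|) : P :=
  iinv (linext_codom L a).

Lemma at_posK d (P : finPOrderType d) (L : linext P) :
  cancel (at_pos L) L.
Proof. by move=> a; rewrite /at_pos f_iinv. Qed.

Lemma linextK d (P : finPOrderType d) (L : linext P) :
  cancel L (at_pos L).
Proof. by move=> x; apply: (@linext_inj _ _ L); rewrite at_posK. Qed.

Definition bump d (P : finPOrderType d) (L : linext P) : pred 'I_#|P| :=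
  fun a => [exists x, (x < at_pos L a)%O && (a == (L x).+1 :> nat)].

Definition bumps d (P : finPOrderType d) (L : linext P) : nat := #|bump L|.

Lemma bumps_le_card d (P : finPOrderType d) (L : linext P) : bumps L <= #|P|.
Proof. by rewrite /bumps -[leqRHS]card_ord max_card. Qed.

(** At position 0 this is the identity, so that [swap_before L b] below is the
    identity for b = 0. *)
Definition pred_pos N (b : 'I_N) : 'I_N :=
  Ordinal (leq_ltn_trans (leq_pred b) (ltn_ord b)).

Lemma pred_posE N (b : 'I_N) : pred_pos b = b.-1 :> nat.
Proof. by []. Qed.

(** When position b is a bump the swapped ordering is no linear extension and
    the default value L is returned. *)
Definition swap_before d (P : finPOrderType d) (L : linext P) (b : 'I_#|P|) :
    linext P :=
  insubd L [ffun x => tperm (pred_pos b) b (L x)].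

(** A transposition of adjacent positions only reverses the pair that it
    moves, and this pair is incomparable when b is not a bump. *)
Lemma swap_beforeE d (P : finPOrderType d) (L : linext P) (b : 'I_#|P|) x :
  0 < b -> ~~ bump L b ->
  swap_before L b x = tperm (pred_pos b) b (L x).
Proof.
move=> b_gt0 nbump.
suff lin : is_linext [ffun x => tperm (pred_pos b) b (L x)].
  by rewrite /swap_before insubdK // ffunE.
apply/andP; split.
  apply/asboolP; exists (fun a => at_pos L (tperm (pred_pos b) b a)) => y.
    by rewrite ffunE tpermK linextK.
  by rewrite ffunE at_posK tpermK.
apply/forallP => y; apply/forallP => z; apply/implyP => yz; rewrite !ffunE.
have Lyz := linext_lt L yz.
have not_ab : ~ (L y = b.-1 :> nat /\ L z = b :> nat).
  case=> Ly /val_inj Lz; case/negP: nbump; apply/existsP; exists y.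
  by rewrite -Lz linextK yz Lz Ly /= prednK.
have tpE (c : 'I_#|P|) : nat_of_ord (tperm (pred_pos b) b c) =
    if c == b.-1 :> nat then nat_of_ord b
    else if c == b :> nat then b.-1 else nat_of_ord c.
  case: tpermP => [->|->|/eqP c1 /eqP c2] /=; rewrite ?eqxx //.
    by case: eqP => // ->.
  by move: c1 c2; rewrite -!val_eqE /= => /negbTE -> /negbTE ->.
rewrite !tpE; do !case: eqP => //; lia.
Qed.

(** The swaps at the positive non-bumps are distinct neighbours; the last term
    accounts for position 0, which has no predecessor. *)
Lemma degree_ge d (P : finPOrderType d) (L : linext P) :
  #|P| <= degree (@transp_adj _ P) L + bumps L + 1.
Proof.
pose S := [pred b : 'I_#|P| | (0 < b) && ~~ bump L b].
have S_le : #|S| <= degree (@transp_adj _ P) L.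
  have inj : {in S &, injective (swap_before L)}.
    move=> b c /andP[b0 nb] /andP[c0 nc] eq_sw.
    wlog bc : b c b0 c0 nb nc eq_sw / b < c.
      case: (ltngtP b c) => [bc|cb|/val_inj //]; last first.
        by move=> H; symmetry; apply: H; rewrite // ltnW.
      by move=> H; apply: H.
    have := swap_beforeE (at_pos L c) b0 nb.
    rewrite eq_sw (swap_beforeE (at_pos L c) c0 nc) at_posK tpermR.
    rewrite tpermD.
    + by move=> /(congr1 (@nat_of_ord _)); rewrite pred_posE => ?; exfalso; lia.
    + by apply/eqP => /(congr1 (@nat_of_ord _)); rewrite pred_posE; lia.
    + by apply/eqP => /(congr1 (@nat_of_ord _)); lia.
  rewrite -(card_in_imset inj) /degree; apply: subset_leq_card.
  apply/fintype.subsetP => _ /imsetP[b /andP[b0 nb] ->].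
  rewrite inE; apply/existsP; exists (pred_pos b); apply/existsP; exists b.
  rewrite /= prednK // eqxx /=; apply/forallP => x.
  by rewrite swap_beforeE.
have cover : #|P| <= #|S| + (bumps L + 1).
  rewrite -[leqLHS]card_ord -(cardC S) leq_add2l.
  have sub : [predC S] \subset [predU bump L & [pred b : 'I_#|P| | val b == 0]].
    apply/fintype.subsetP => b; rewrite !inE negb_and negbK -leqNgt leqn0 orbC.
    by rewrite unfold_in.
  apply: leq_trans (subset_leq_card sub) _.
  apply: leq_trans
    (leq_addr #|[predI bump L & [pred b : 'I_#|P| | val b == 0]]| _) _.
  rewrite cardUI leq_add2l.
  apply/card_le1_eqP => b c; rewrite !inE => /eqP b0 /eqP c0.
  by apply: val_inj; rewrite /= b0 c0.
by rewrite -addnA; apply: leq_trans cover _; rewrite leq_add2r.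
Qed.

Lemma degree_le d (P : finPOrderType d) (L : linext P) :
  degree (@transp_adj _ P) L <= #|P|.
Proof.
rewrite -[leqRHS]card_ord; apply: leq_trans (leq_image_card (swap_before L) _).
apply: subset_leq_card; apply/fintype.subsetP => L'; rewrite inE.
case/existsP=> a /existsP[b /andP[/eqP ba /forallP L'E]].
suff -> : L' = swap_before L b by exact: codom_f.
apply: val_inj.
have pb : pred_pos b = a by apply: val_inj; rewrite /= ba.
have ffE : val L' = [ffun x => tperm (pred_pos b) b (L x)].
  by apply/ffunP => x; rewrite ffunE pb; apply/eqP; apply: L'E.
by rewrite /swap_before -ffE valKd.
Qed.

Lemma max_degree_le d (P : finPOrderType d) :
  (max_degree (@transp_adj _ P) <= #|P|)%N.
Proof. by apply/bigmax_leqP => L _; exact: degree_le. Qed.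

(** * Encoding linear extensions by their bumps *)

Definition covers d (P : finPOrderType d) (x y : P) : bool :=
  (x < y)%O && [forall z, ~~ ((x < z)%O && (z < y)%O)].

(** An element strictly between x and y would need a position between two
    consecutive ones. *)
Lemma linext_succ_covers d (P : finPOrderType d) (L : linext P) (x y : P) :
  (x < y)%O -> L y = (L x).+1 :> nat -> covers x y.
Proof.
move=> xy Lxy; rewrite /covers xy; apply/forallP => z; apply/negP => /andP[xz zy].
by have := linext_lt L xz; have := linext_lt L zy; lia.
Qed.

(** The letter at a position describes the element there: relative to its
    predecessor by [k] at a bump, and by its chain [q] otherwise. *)
Definition linext_code d (P : finPOrderType d) (I Q : finType) (k : P -> P -> I)
    (q : P -> Q) (L : linext P) : {ffun 'I_#|P| -> I + Q} :=
  [ffun a => if [pick x | (x < at_pos L a)%O && (a == (L x).+1 :> nat)] is Some x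
             then inl (k x (at_pos L a)) else inr (q (at_pos L a))].

Definition is_inl (A B : Type) (s : A + B) : bool :=
  if s is inl _ then true else false.

Lemma is_inl_linext_code d (P : finPOrderType d) (I Q : finType)
    (k : P -> P -> I) (q : P -> Q) (L : linext P) a :
  is_inl (linext_code k q L a) = bump L a.
Proof.
rewrite ffunE /bump; case: pickP => [x Hx|H] /=.
  by symmetry; apply/existsP; exists x.
by symmetry; apply/negbTE/existsPn => x; rewrite H.
Qed.

(** The elements are recovered position by position.  At a bump, both elements
    cover the same predecessor and share the label [k].  Elsewhere both lie in
    one chain, and the smaller of them would already have been placed
    earlier. *)
Lemma linext_code_inj d (P : finPOrderType d) (I Q : finType) (k : P -> P -> I)
    (q : P -> Q) :
  (forall x y z, covers x y -> covers x z -> k x y = k x z -> y = z) ->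
  (forall x y, q x = q y -> (x >=< y)%O) ->
  injective (linext_code k q).
Proof.
move=> kinj qcomp L M eqc.
have line (L1 M1 : linext P) (a : 'I_#|P|) :
    (forall b : 'I_#|P|, b < a -> at_pos L1 b = at_pos M1 b) ->
    ~~ (at_pos L1 a < at_pos M1 a)%O.
  move=> IH; apply/negP => lt.
  have := linext_lt M1 lt; rewrite at_posK => ltb.
  have := IH _ ltb; rewrite linextK => /(congr1 L1); rewrite !at_posK => eqb.
  by move: ltb; rewrite eqb ltnn.
have same a : at_pos L a = at_pos M a.
  have [n] := ubnP (nat_of_ord a); elim: n a => // n IHn a an.
  have IH (b : 'I_#|P|) : b < a -> at_pos L b = at_pos M b.
    by move=> ba; apply: IHn; apply: leq_trans ba _; rewrite -ltnS.
  have /ffunP /(_ a) := eqc; rewrite !ffunE.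
  case: pickP => [x /andP[xL /eqP ax]|_]; case: pickP => [y /andP[yM /eqP ay]|_] //.
    case=> kxy.
    have xy : x = y.
      have Lx : L x = M y by apply: ord_inj; apply: succn_inj; rewrite -ax -ay.
      have := IH (L x); rewrite ax => /(_ (leqnn _)).
      by rewrite linextK Lx linextK.
    rewrite -{}xy in yM ay kxy.
    apply: kinj kxy.
      by apply: (linext_succ_covers (L := L)) => //; rewrite at_posK ax.
    by apply: (linext_succ_covers (L := M)) => //; rewrite at_posK ay.
  case=> /qcomp /Order.POrderTheory.comparable_ltgtP[lt|lt|//].
    by have := line L M a IH; rewrite lt.
  by have := line M L a (fun b ba => esym (IH b ba)); rewrite lt.
apply: val_inj; apply/ffunP => x /=.
by rewrite -[x](linextK L) at_posK same at_posK.
Qed.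

(** The weights are swapped on purpose: a bump letter, of which there are
    #|I|, weighs #|Q|, so both kinds contribute #|I| * #|Q| to the sum over
    letters while extensions with many bumps weigh most. *)
Definition weight (I Q : finType) (s : I + Q) : nat :=
  if is_inl s then #|Q| else #|I|.

Lemma sum_weight (I Q : finType) :
  \sum_(s : I + Q) weight s = 2 * #|I| * #|Q|.
Proof.
rewrite big_sumType /= /weight /= !sum_nat_const.
by rewrite [X in _ + X]mulnC addnn -mul2n mulnA.
Qed.

Lemma prod_weight_linext_code d (P : finPOrderType d) (I Q : finType)
    (k : P -> P -> I) (q : P -> Q) (L : linext P) :
  \prod_a weight (linext_code k q L a) = #|Q| ^ bumps L * #|I| ^ (#|P| - bumps L).
Proof.
under eq_bigr => a _ do rewrite /weight is_inl_linext_code.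
rewrite (bigID (bump L)) /=; congr (_ * _).
  under eq_bigr => a -> do [].
  by rewrite prod_nat_const.
under eq_bigr => a /negbTE -> do [].
rewrite prod_nat_const; congr (_ ^ _).
by rewrite -[in RHS](card_ord #|P|) -(cardC (bump L)) /bumps addKn.
Qed.

(** The total weight of the codes is at most that of all words, which is a
    power of the sum over letters. *)
Lemma sum_bumps_le d (P : finPOrderType d) (I Q : finType) (k : P -> P -> I)
    (q : P -> Q) :
  (forall x y z, covers x y -> covers x z -> k x y = k x z -> y = z) ->
  (forall x y, q x = q y -> (x >=< y)%O) ->
  \sum_(L : linext P) #|Q| ^ bumps L * #|I| ^ (#|P| - bumps L)
    <= (2 * #|I| * #|Q|) ^ #|P|.
Proof.
move=> kinj qcomp; have cinj := linext_code_inj kinj qcomp.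
under eq_bigr => L _ do rewrite -(prod_weight_linext_code k q L).
rewrite -[X in _ <= _ ^ X]card_ord -sum_weight -prod_nat_const.
rewrite (bigA_distr_bigA (fun (_ : 'I_#|P|) (s : I + Q) => weight s)) /=.
rewrite -(big_imset (fun c : {ffun 'I_#|P| -> I + Q} => \prod_a weight (c a))
  (in2W cinj : {in predT &, injective _})) /=.
by rewrite [leqRHS](bigID (mem (linext_code k q @: predT))) /= leq_addr.
Qed.

(** * Many linear extensions *)

(** N^N <= (N + 1) ... (2N) = 'C(2N, N) N!, and 'C(2N, N) <= 2^(2N). *)
Lemma expnn_le_fact N : N ^ N <= 4 ^ N * N`!.
Proof.
have -> : 4 ^ N = 2 ^ (N + N) by rewrite expnD -expnMn.
apply: (@leq_trans ('C(N + N, N) * N`!)).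
  rewrite bin_ffact ffact_prod -{2}(card_ord N) -prod_nat_const.
  by apply: leq_prod => i _; have := ltn_ord i; lia.
rewrite leq_mul2r; apply/orP; right.
have := expnDn 1 1 (N + N).
under eq_bigr => i _ do rewrite !exp1n !muln1.
by move=> ->; rewrite (bigD1 (inord N)) //= inordK ?leq_addr // ltnS leq_addr.
Qed.

Lemma exists_sorting (P : finType) (K : nat) (r : P -> 'I_K) :
  exists f : P -> 'I_#|P|, injective f /\ forall x y, r x < r y -> f x < f y.
Proof.
pose leT := [rel x y : P | r x <= r y].
pose s := sort leT (enum P).
have mems x : x \in s by rewrite mem_sort mem_enum.
have szs : size s = #|P| by rewrite size_sort -cardE.
have lts x : index x s < #|P| by rewrite -szs index_mem.
exists (fun x => Ordinal (lts x)); split=> [x y [] /(index_inj _ _)|x y rxy].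
  by apply.
rewrite /= ltnNge; apply/negP => le.
have tr : transitive leT by move=> ? ? ? /=; apply: leq_trans.
have srt : sorted leT s by apply: sort_sorted => ? ?; apply: leq_total.
have := sorted_leq_index tr (fun x => leqnn _) srt _ _ (mems y) (mems x) le.
by rewrite /= leqNgt rxy.
Qed.

(** Colour each permutation s by r \o s.  There are at most K ^ #|P| colours,
    and two permutations s, t of one colour differ by a permutation preserving r;
    composed with a sorting by r, the latter yields a linear extension, so no
    colour is used more often than there are linear extensions. *)
Lemma fact_le_linext d (P : finPOrderType d) (K : nat) (r : P -> 'I_K) :
  (forall x y, (x < y)%O -> r x < r y) ->
  (#|P|)`! <= K ^ #|P| * #|{: linext P}|.
Proof.
move=> rmono.
have [f [finj fmono]] := exists_sorting r.
pose col (s : {perm P}) : {ffun P -> 'I_K} := [ffun x => r (s x)].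
pose fib c := [set s : {perm P} | col s == c].
have fib_le c : #|fib c| <= #|{: linext P}|.
  case: (fintype.pickP (mem (fib c))) => [t tc|none]; last by rewrite eq_card0.
  have rst (s : {perm P}) x : s \in fib c -> r ((s^-1 * t)%g x) = r x.
    move: tc; rewrite !inE permM => /eqP <- /eqP /ffunP /(_ ((s^-1)%g x)).
    by rewrite !ffunE permKV.
  have lin (s : {perm P}) : s \in fib c ->
      is_linext [ffun x => f ((s^-1 * t)%g x)].
    move=> sc; apply/andP; split.
      apply/asboolP/inj_card_bij; last by rewrite card_ord.
      by move=> x y; rewrite !ffunE => /finj /perm_inj.
    apply/forallP => x; apply/forallP => y; apply/implyP => xy; rewrite !ffunE.
    by apply: fmono; rewrite !rst // rmono.
  have [L0 _|noL] := fintype.pickP (fun _ : linext P => true); last first.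
    by have := noL (Linext (lin t tc)).
  pose ext (s : {perm P}) := insubd L0 [ffun x => f ((s^-1 * t)%g x)].
  have ext_inj : {in fib c &, injective ext}.
    move=> s1 s2 /lin s1c /lin s2c /(congr1 val).
    rewrite /ext !insubdK // => /ffunP eqf.
    apply: invg_inj; apply: (mulIg t); apply/permP => x; apply: finj.
    by have := eqf x; rewrite !ffunE.
  by rewrite -(card_in_imset ext_inj) max_card.
have -> : (#|P|)`! = #|{perm P}|.
  rewrite -[in LHS]cardsT -card_perm; apply: eq_card => s; rewrite !inE.
  by apply/fintype.subsetP => x _; rewrite inE.
rewrite -sum1_card (partition_big col predT) //=.
apply: (@leq_trans (\sum_(c : {ffun P -> 'I_K}) #|{: linext P}|)).
  apply: leq_sum => c _; apply: leq_trans (fib_le c).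
  by rewrite -sum1_card; apply/eq_leq/eq_bigl => s; rewrite !inE.
by rewrite sum_nat_const card_ffun card_ord.
Qed.

(** * The grid *)

Lemma card_grid n m : #|grid n m| = m ^ n.
Proof. by rewrite -[in RHS](card_ord m) -card_tuple. Qed.

Lemma grid_leP n m (x y : grid n m) :
  reflect (forall i, tnth x i <= tnth y i) (x <= y)%O.
Proof. by rewrite Order.TupleProdOrder.leEtprod; exact: forallP. Qed.

Lemma grid_ltP n m (x y : grid n m) : (x < y)%O ->
  exists i, tnth x i < tnth y i.
Proof.
rewrite lt_leAnge => /andP[_ /grid_leP nyx]; apply/existsP.
apply: contraT => /existsPn H; case: nyx => i.
by rewrite leqNgt H.
Qed.

Definition rank n m (x : grid n m) : nat := \sum_i tnth x i.

Lemma rank_lt n m (x y : grid n m) : (x < y)%O -> rank x < rank y.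
Proof.
move=> xy; have [i xi] := grid_ltP xy; have /grid_leP le := ltW xy.
rewrite /rank (bigD1 i) //= [X in _ < X](bigD1 i) //= -addSn.
by apply: leq_add => //; apply: leq_sum => j _.
Qed.

Lemma rank_bound n m (x : grid n m) : 0 < n -> rank x < n * m.
Proof.
move=> n_gt0; have le : rank x <= \sum_(i < n) m.-1.
  by apply: leq_sum => i _; have := ltn_ord (tnth x i); lia.
move: le; rewrite sum_nat_const card_ord => /leq_ltn_trans; apply.
have := ltn_ord (tnth x (Ordinal n_gt0)); rewrite ltn_pmul2l //; lia.
Qed.

Definition raised n m (x y : grid n.+1 m) : 'I_n.+1 :=
  odflt ord0 [pick i | tnth x i < tnth y i].

(** If y and z both cover x and exceed it in the same coordinate, so does their
    coordinatewise minimum u; as x < u <= y and x < u <= z, both equal u. *)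
Lemma raised_inj n m (x y z : grid n.+1 m) :
  covers x y -> covers x z -> raised x y = raised x z -> y = z.
Proof.
have raisedP (u v : grid n.+1 m) : (u < v)%O ->
    tnth u (raised u v) < tnth v (raised u v).
  move=> /grid_ltP[i ui]; rewrite /raised; case: pickP => //= H.
  by have := H i; rewrite /= ui.
move=> /andP[xy /forallP cy] /andP[xz /forallP cz] eqr.
have ry := raisedP _ _ xy; have := raisedP _ _ xz; rewrite -eqr => rz.
have /grid_leP ley := ltW xy; have /grid_leP lez := ltW xz.
pose u : grid n.+1 m :=
  [tuple (if tnth y i < tnth z i then tnth y i else tnth z i) | i < n.+1].
have uE i : tnth u i = (if tnth y i < tnth z i then tnth y i else tnth z i).
  by rewrite tnth_mktuple.
have xu : (x < u)%O.
  rewrite lt_leAnge; apply/andP; split.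
    by apply/grid_leP => i; rewrite uE; case: ifP.
  apply/negP => /grid_leP /(_ (raised x y)); rewrite uE.
  by case: ifP => _; rewrite leqNgt ?ry ?rz.
have uy : (u <= y)%O.
  apply/grid_leP => i; rewrite uE; case: ifP => //; lia.
have uz : (u <= z)%O.
  apply/grid_leP => i; rewrite uE; case: ifP => //; lia.
have -> : y = u.
  move: uy; rewrite le_eqVlt => /predU1P[//|uy].
  by have := cy u; rewrite xu uy.
move: uz; rewrite le_eqVlt => /predU1P[//|uz].
by have := cz u; rewrite xu uz.
Qed.

Definition line n m (x : grid n.+1 m) : n.-tuple 'I_m := [tuple of behead x].

Lemma line_comparable n m (x y : grid n.+1 m) : line x = line y -> (x >=< y)%O.
Proof.
move=> xy.
have same j : tnth x (lift ord0 j) = tnth y (lift ord0 j).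
  have := congr1 (fun t : n.-tuple 'I_m => tnth t j) xy.
  rewrite /line !tnth_behead.
  by have -> : inord j.+1 = lift ord0 j by apply: val_inj; rewrite /= inordK // ltnS.
rewrite /Order.comparable.
have [le|lt] := leqP (tnth x ord0) (tnth y ord0); apply/orP; [left|right];
  apply/grid_leP => i; case: (unliftP ord0 i) => [j ->|->] //; rewrite ?same //.
exact: ltnW.
Qed.

Lemma grid_sum_bumps n m :
  \sum_(L : linext (grid n.+1 m)) (m ^ n) ^ bumps L * n.+1 ^ (m ^ n.+1 - bumps L)
    <= (2 * n.+1 * m ^ n) ^ (m ^ n.+1).
Proof.
have := sum_bumps_le (@raised_inj n m) (@line_comparable n m).
by rewrite card_ord card_tuple card_ord card_grid.
Qed.

(** From [fact_le_linext] with K = n.+1 * m ranks; the exponent counts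
    N = m ^ n.+1 elements, and N^N = (m * m ^ n)^N cancels the factor m^N. *)
Lemma grid_linext_ge n m : 0 < m ->
  (m ^ n) ^ (m ^ n.+1) <= (4 * n.+1) ^ (m ^ n.+1) * #|{: linext (grid n.+1 m)}|.
Proof.
move=> m_gt0; set N := m ^ n.+1.
pose r (x : grid n.+1 m) : 'I_(n.+1 * m) := Ordinal (rank_bound x (ltn0Sn n)).
have rmono (x y : grid n.+1 m) : (x < y)%O -> r x < r y by exact: rank_lt.
have := fact_le_linext rmono; rewrite card_grid -/N => fact_le.
have mN : 0 < m ^ N by rewrite expn_gt0 m_gt0.
rewrite -(leq_pmul2l mN) -expnMn -expnS -/N.
apply: leq_trans (expnn_le_fact N) _.
apply: (@leq_trans (4 ^ N * ((n.+1 * m) ^ N * #|{: linext (grid n.+1 m)}|))).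
  by rewrite leq_mul2l fact_le orbT.
by rewrite !mulnA -!expnMn leq_mul2r; apply/orP; right; rewrite mulnA [m * _]mulnC.
Qed.

(** * Linear extensions of the grid with many bumps *)

Local Open Scope ring_scope.

(** Markov's inequality for the weights of [grid_sum_bumps], with m ^ n >= m
    used to replace the base (m ^ n) / n.+1 by m / n.+1. *)
Lemma many_bumps_rare (R : realType) n m (t : R) : (1 <= n)%N -> (n < m)%N ->
  #|[pred L : linext (grid n.+1 m) | t <= (bumps L)%:R]|%:R
      * expR (t * (ln m%:R - ln n.+1%:R))
    <= (8 * n.+1%:R) ^+ (m ^ n.+1)%N * #|{: linext (grid n.+1 m)}|%:R.
Proof.
move=> n_ge1 nm; set N := (m ^ n.+1)%N; set bad := [pred L | _].
have m_gt0 : (0 < m)%N by apply: leq_trans nm.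
have n0 : (0 : R) < n.+1%:R by rewrite ltr0n.
have m0 : (0 : R) < m%:R by rewrite ltr0n.
have nN0 : (0 : R) < n.+1%:R ^+ N by rewrite exprn_gt0.
have w0 : (0 : R) < m%:R ^+ n by rewrite exprn_gt0.
rewrite -(ler_pM2l nN0).
apply: (@le_trans _ _ ((2 * n.+1 * m ^ n) ^ N)%N%:R); last first.
  have := grid_linext_ge n m_gt0; rewrite -(ler_nat R) -/N natrM !natrX natrM.
  rewrite !natrM natrX => le.
  rewrite exprMn; apply: (le_trans (ler_wpM2l _ le)).
    by rewrite exprn_ge0 // mulr_ge0.
  rewrite [leLHS]mulrA [leRHS]mulrA -!exprMn.
  by have -> : 2 * n.+1%:R * (4 * n.+1%:R) = n.+1%:R * (8 * n.+1%:R) :> R by ring.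
apply: (@le_trans _ _ (\sum_(L : linext (grid n.+1 m))
    (m ^ n) ^ bumps L * n.+1 ^ (N - bumps L))%N%:R); last first.
  by rewrite ler_nat; exact: grid_sum_bumps.
rewrite natr_sum (bigID bad) /=.
rewrite -[leLHS]addr0; apply: lerD; last by apply: sumr_ge0.
have -> : n.+1%:R ^+ N * (#|bad|%:R * expR (t * (ln m%:R - ln n.+1%:R))) =
    \sum_(L in bad) (n.+1%:R ^+ N * expR (t * (ln m%:R - ln n.+1%:R))).
  by rewrite sumr_const -[RHS]mulr_natl mulrCA.
apply: ler_sum => L Lt.
have bN : (bumps L <= N)%N by have := bumps_le_card L; rewrite card_grid.
rewrite natrM !natrX -{1}(subnK bN) exprD -mulrA [leRHS]mulrC.
apply: ler_wpM2l; first by rewrite exprn_ge0 // ltW.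
apply: (@le_trans _ _
    (n.+1%:R ^+ bumps L * expR ((bumps L)%:R * (ln m%:R - ln n.+1%:R)))).
  apply: ler_wpM2l; first by rewrite exprn_ge0 // ltW.
  rewrite ler_expR ler_wpM2r // subr_ge0 ler_ln ?posrE // ler_nat //.
rewrite mulrC expRM_natl expRB !lnK ?posrE //.
rewrite -exprMn divfK ?gt_eqF //; apply: lerXn2r; rewrite ?nnegrE;
  [exact: ltW|exact: ltW|].
by rewrite -natrX ler_nat -{1}(expn1 m) leq_exp2l // (leq_trans _ nm).
Qed.

(** With l = ln n and M = ln m, the exponent is
    4 l N - 24 l N + x N l / 2 <= -19.5 l N <= -N, and
    exp(-N) <= 1 / N <= 1 / M <= x since x = 48 l / M. *)
Lemma rare_exponent (R : realType) (l M x N : R) :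
  1 / 2 <= l -> 0 < M -> x * M = 48 * l -> x <= 1 -> M <= N ->
  expR (N * (4 * l) - (x * N / 2) * (M - l)) <= x.
Proof.
move=> l2 M0 xM x1 MN.
have xMl : x * N * l <= N * l by rewrite -mulrA ler_piMl // mulr_ge0; lra.
have -> : N * (4 * l) - x * N / 2 * (M - l) =
    N * (4 * l) - N / 2 * (x * M) + x * N * l / 2 by field.
rewrite xM.
have Nl : N / 2 <= N * l by rewrite ler_pM2l; lra.
have le : N * (4 * l) - N / 2 * (48 * l) + x * N * l / 2 <= - N by lra.
apply: le_trans (_ : expR (- N) <= _); first by rewrite ler_expR.
rewrite expRN.
have xE : x = 48 * l / M by rewrite -xM mulfK // gt_eqF.
apply: (@le_trans _ _ M^-1).
  rewrite lef_pV2 ?posrE ?expR_gt0 //; have := expR_ge1Dx N; lra.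
by rewrite xE ler_peMl ?invr_ge0; lra.
Qed.

Lemma ln_natr_ge_half (R : realType) k : (2 <= k)%N -> 1 / 2 <= ln k%:R :> R.
Proof.
move=> k2; have k0 : (0 : R) < k%:R by rewrite ltr0n; lia.
have h : k%:R^-1 <= 1 / 2 :> R.
  by rewrite mul1r lef_pV2 ?posrE // (ler_nat R 2 k).
have kV : 0 < k%:R^-1 :> R by rewrite invr_gt0.
have := @le_ln1Dx R (k%:R^-1 - 1); rewrite addrCA subrr addr0 lnV ?posrE //.
by move=> /(_ _); lra.
Qed.

Lemma ln_mul8_le (R : realType) k : (2 <= k)%N ->
  ln (8 * k%:R) <= 4 * ln k%:R :> R.
Proof.
move=> k2; have k0 : (0 : R) < k%:R by rewrite ltr0n; lia.
rewrite lnM ?posrE // [X in X + _](_ : _ = 3 * ln 2); last first.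
  by rewrite (_ : 8 = 2 ^+ 3 :> R) ?lnXn ?mulr_natl //; ring.
have : ln 2 <= ln k%:R :> R by rewrite ler_ln ?posrE // (ler_nat R 2 k).
lra.
Qed.

(** A degree below N (1 - x) forces more than x N - 1 bumps, which is at least
    x N / 2 because x N >= 2: indeed x = 48 l / M, N >= m^2 and M <= m. *)
Lemma almost_all_degree_ge (R : realType) n m (x : R) : (2 <= n)%N -> (2 <= m)%N ->
  x * ln m%:R = 48 * ln n%:R -> x <= 1 ->
  all_but_fraction x (fun L : linext (grid n m) =>
    (m ^ n)%:R * (1 - x) <= (degree (@transp_adj _ (grid n m)) L)%:R).
Proof.
case: n => // n n2 m2 xM x1.
have l2 := ln_natr_ge_half R n2; have M2 := ln_natr_ge_half R m2.
set l : R := ln n.+1%:R in xM l2 *; set M : R := ln m%:R in xM M2 *.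
set N := (m ^ n.+1)%N.
have mN : (m * m <= N)%N by rewrite mulnn leq_exp2l.
have n0 : (0 : R) < n.+1%:R by rewrite ltr0n.
have m0 : (0 : R) < m%:R by rewrite ltr0n; lia.
have Mm : M <= m%:R.
  have := @le_ln1Dx R (m%:R - 1); rewrite addrCA subrr addr0.
  by move=> /(_ _); rewrite -/M; lra.
have m2R : 2 <= m%:R :> R by rewrite (ler_nat R 2 m).
have mNR : m%:R * m%:R <= N%:R :> R by rewrite -natrM ler_nat.
have MN : M <= N%:R by nra.
have xN : 2 <= x * N%:R.
  rewrite -(ler_pM2r (_ : 0 < M)); last by lra.
  rewrite mulrAC xM; nra.
have ltnm : (n.+1 < m)%N.
  rewrite -(ltr_nat R) -ltr_ln ?posrE // -/l -/M.
  have : x * M <= M by rewrite ler_piMl //; lra.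
  by rewrite xM; lra.
have rare := many_bumps_rare (x * N%:R / 2) n2 (ltnW ltnm).
rewrite /all_but_fraction.
apply: (@le_trans _ _
    #|[pred L : linext (grid n.+1 m) | x * N%:R / 2 <= (bumps L)%:R]|%:R).
  rewrite ler_nat.
  apply: subset_leq_card; apply/fintype.subsetP => L; rewrite !inE -ltNge => lt.
  have := degree_ge L; rewrite card_grid -/N -(ler_nat R) !natrD.
  by move: lt; rewrite mulrBr mulr1 [_ * x]mulrC; lra.
rewrite -(ler_pM2r (expR_gt0 (x * N%:R / 2 * (M - l)))).
apply: le_trans rare _; rewrite -/N mulrAC.
apply: ler_wpM2r; first by [].
rewrite -[X in X ^+ _]lnK ?posrE ?mulr_gt0 // -expRM_natl.
have := rare_exponent l2 (_ : 0 < M) xM x1 MN.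
rewrite expRB ler_pdivrMr ?expR_gt0 // => /(_ _) H.
apply: le_trans (H _); last by lra.
by rewrite ler_expR ler_wpM2l // ln_mul8_le.
Qed.

(** * The degree bound and its limit *)

Local Open Scope classical_set_scope.

Lemma lg_ratioE (R : realType) n m :
  48 * lg n%:R / lg m%:R = 48 * (ln n%:R / ln m%:R) :> R.
Proof.
have ln2 := ln_natr_ge_half R (leqnn 2).
rewrite /lg -!mulrA; congr (48 * (_ * _)).
by rewrite invfM invrK mulrCA mulVf ?mulr1 // gt_eqF //; lra.
Qed.

(** The bound weakens as the error term grows, and x <= x^(1/4) for x <= 1. *)
Lemma almost_all_degree_ge_root (R : realType) n m :
  (2 <= n)%N -> (2 <= m)%N ->
  let eps : R := (48 * lg n%:R / lg m%:R) `^ (1 / 4) in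
  all_but_fraction eps
    (fun L : linext (grid n m) =>
       (m ^ n)%:R * (1 - eps) <= (degree (@transp_adj _ (grid n m)) L)%:R).
Proof.
move=> n2 m2 eps.
have l2 := ln_natr_ge_half R n2; have M2 := ln_natr_ge_half R m2.
rewrite lg_ratioE in @eps *; set x := 48 * _ in @eps *.
have x0 : 0 < x by rewrite mulr_gt0 // divr_gt0; lra.
have [x1|x1] := lerP x 1; last first.
  have eps1 : 1 <= eps by rewrite -(powRr0 x) ler_powR ?ltW //; lra.
  rewrite /all_but_fraction; apply: (@le_trans _ _ (1 * #|{: linext (grid n m)}|%:R)).
    by rewrite mul1r ler_nat max_card.
  by rewrite ler_wpM2r.
have x_eps : x <= eps by apply: ger1_powR; rewrite ?x0 //; lra.
have xM : x * ln m%:R = 48 * ln n%:R.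
  by rewrite -mulrA divfK // gt_eqF //; lra.
apply: le_trans (le_trans (almost_all_degree_ge n2 m2 xM x1) _).
  rewrite ler_nat; apply: subset_leq_card; apply/fintype.subsetP => L.
  rewrite !inE; apply: contra => /(le_trans _); apply.
  by rewrite ler_wpM2l // lerD2l lerN2.
by rewrite ler_wpM2r.
Qed.

(** Here g = ln n, so the little-o hypothesis with constant e^4 / 48 gives a
    fourth root below e. *)
Lemma root_cvg0 (R : realType) (n : nat -> nat) (g : nat -> R) :
  (\forall m \near \oo, (2 <= n m)%N) ->
  g =o_\oo (fun m => ln m%:R : R) ->
  (\forall m \near \oo, (n m)%:R = expR (g m)) ->
  (48 * lg (n m)%:R / lg m%:R) `^ (1 / 4) @[m --> \oo] --> (0 : R).
Proof.
move=> n2 /eqoP go ng; apply/cvgr0Pnorm_le => e e0.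
have e48 : 0 < e ^+ 4 / 48 by rewrite divr_gt0 // exprn_gt0.
have m2 : \forall m \near \oo, (2 <= m)%N by exists 2.
near=> m.
have n2m : (2 <= n m)%N by near: m.
have m2m : (2 <= m)%N by near: m.
have M2 := ln_natr_ge_half R m2m; have l2 := ln_natr_ge_half R n2m.
have gE : g m = ln (n m)%:R by rewrite (_ : (n m)%:R = expR (g m)) ?expRK //; near: m.
have gm : `|g m| <= e ^+ 4 / 48 * `|ln m%:R| by near: m; exact: go.
rewrite gE !ger0_norm in gm; [|lra|lra].
rewrite ger0_norm ?powR_ge0 // lg_ratioE.
have -> : e = (e ^+ 4) `^ (1 / 4).
  rewrite -powR_mulrn ?ltW // -powRrM (_ : 4%:R * (1 / 4) = 1); last by field.
  by rewrite powRr1 ?ltW.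
have q0 : 0 <= 1 / 4 :> R by lra.
have x0 : 0 < 48 * (ln (n m)%:R / ln m%:R) :> R.
  by rewrite mulr_gt0 // divr_gt0; lra.
apply: (ge0_ler_powR q0); rewrite ?nnegrE ?exprn_ge0 ?(ltW e0) ?(ltW x0) //.
rewrite mulrA ler_pdivrMr; last by lra.
by move: gm; lra.
Unshelve. all: by end_near.
Qed.

Theorem corollary6 (R : realType) :
  (forall n m : nat, (2 <= n)%N -> (41 <= m)%N ->
     let eps : R := (48 * lg n%:R / lg m%:R) `^ (1 / 4) in
     all_but_fraction eps
       (fun L : linext (grid n m) =>
          (m ^ n)%:R * (1 - eps) <= (degree (@transp_adj _ (grid n m)) L)%:R))
  /\
  (forall n : nat -> nat,
     (\forall m \near \oo, (2 <= n m)%N) ->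
     (exists g : nat -> R,
        g =o_\oo (fun m => ln m%:R : R) /\
        \forall m \near \oo, (n m)%:R = expR (g m)) ->
     almost_regular R (fun m => @transp_adj _ (grid (n m) m))).
Proof.
split=> [n m n2 m41|n n2 [g [go ng]]].
  by apply: almost_all_degree_ge_root => //; apply: leq_trans m41.
pose eps m : R := (48 * lg (n m)%:R / lg m%:R) `^ (1 / 4).
have eps0 : eps @ \oo --> (0 : R) by exact: root_cvg0 n2 go ng.
exists eps, eps; split=> //.
near=> m.
have n2m : (2 <= n m)%N by near: m.
have m2m : (2 <= m)%N by near: m; exists 2.
apply: le_trans (almost_all_degree_ge_root R n2m m2m).
rewrite ler_nat; apply: subset_leq_card; apply/fintype.subsetP => L.
rewrite !inE -/(eps m); apply: contra.
(* For eps m > 1 the required lower bound on the degree is at most 0. *)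
have [e1|e1] := lerP (eps m) 1; last first.
  by move=> _; apply: le_trans (ler0n R _); rewrite mulr_le0_ge0 // subr_le0 ltW.
apply: le_trans; rewrite mulrC ler_wpM2r ?subr_ge0 // ler_nat.
by have := max_degree_le (grid (n m) m); rewrite card_grid.
Unshelve. all: by end_near.
Qed.
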